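(* Let $n$ be a natural number with $n\equiv 4 \pmod 8$ and $n\not\equiv 0 \pmod 5$. Then, for any odd integer $t\geq (n+6)/2$, there exist infinitely many Salem numbers $\alpha$ of degree $2t$ such that $\alpha^{n}-1$ is a unit.
   Context: A Salem number is a real algebraic integer greater than $1$ whose other conjugates (over $\mathbb{Q}$) all lie in the closed unit disc, with at least one conjugate lying on the unit circle. The degree of an algebraic number is its degree over $\mathbb{Q}$. A unit is an algebraic integer whose inverse is also an algebraic integer. *)

(* Defs.v *)
From mathcomp Require Import all_boot all_order all_algebra all_field.
From mathcomp Require Import classical_sets cardinality.

Set Implicit Arguments.
Unset Strict Implicit.
Unset Printing Implicit Defensive.

Import Order.TTheory GRing.Theory Num.Theory.
Local Open Scope ring_scope.

(* Algebraic numbers are the elements of algC; minCpoly x is the minimal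
   polynomial of x over Q, with its coefficients mapped into algC. *)

Definition alg_degree (x : algC) : nat := (size (minCpoly x)).-1.

Definition conjugate (x z : algC) : bool := root (minCpoly x) z.

Definition salem (x : algC) : Prop :=
  [/\ x \is Num.real, x \in Aint, 1 < x,
      forall z : algC, conjugate x z -> z != x -> `|z| <= 1
    & exists2 z : algC, conjugate x z & `|z| = 1].

(* 0 has to be excluded explicitly, because 0^-1 = 0 in MathComp. *)
Definition alg_unit (x : algC) : Prop :=
  [/\ x \in Aint, x != 0 & x^-1 \in Aint].

(* Main.v *)
(* Write n = 4k with k odd, and let E be the monic integer polynomial with
   E(x + 1/x) = (x - 1/x)(x^(2k) - x^(-2k)).  If y = x + 1/x is a root of
   R = (Y - a) P - 1 where E divides P, then E(y) is a unit, hence so is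
   x^n - 1.  Take P = (Y - z) E F of even degree t - 1, with F monic, all roots
   of P in [-2, 2], and roots of P simple except possibly z, which may be a
   double root where P'' < 0.  Then, sorting the roots as
   r_0 <= r_1 <= ... <= r_(t-2), each r_(2i) < r_(2i+1), and P < 0 in between,
   so for a large R has two roots in each of these (t - 1)/2 intervals and one
   more root y > a.  Thus X^t R(X + 1/X) has exactly one root alpha > 1, its
   inverse, and all other roots on the unit circle.

   Irreducibility: a proper integer factor h that has neither alpha nor
   1/alpha as a root has h(x) h(1/x) = +-1 where x + 1/x = a, because R(a) = -1;
   but this product has modulus prod |a - (w + 1/w)| > 1 over the roots w of h. *)

Require Import Defs.
From mathcomp Require Import all_boot all_order all_algebra all_field.
From mathcomp Require Import ring lra zify.
From mathcomp Require Import classical_sets cardinality.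

Set Implicit Arguments.
Unset Strict Implicit.
Unset Printing Implicit Defensive.

Import Order.TTheory GRing.Theory Num.Theory.
Local Open Scope ring_scope.

(** * Perturbing a real-rooted polynomial *)

Section RealRoots.
Variable K : rcfType.
Implicit Types (s : seq K) (P : {poly K}).

Definition root_poly s : {poly K} := \prod_(r <- s) ('X - r%:P).

Lemma horner_root_poly s x : (root_poly s).[x] = \prod_(r <- s) (x - r).
Proof. by rewrite horner_prod; apply: eq_bigr => r _; rewrite hornerXsubC. Qed.

Lemma root_poly_monic s : root_poly s \is monic.
Proof. exact: monic_prod_XsubC. Qed.

Lemma prod_even_opp s (F : K -> K) :
  ~~ odd (size s) -> \prod_(r <- s) F r = \prod_(r <- s) - F r.
Proof.
move=> es; rewrite [RHS](eq_bigr (fun r => -1 * F r)) => [|r _]; last by rewrite mulN1r.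
by rewrite big_split /= big_const_seq count_predT iter_mulr_1 -signr_odd (negPf es) mul1r.
Qed.

Lemma prod_even_le0 s (F : K -> K) :
  ~~ odd (size s) -> {in s, forall r, F r <= 0} -> 0 <= \prod_(r <- s) F r.
Proof.
move=> es Fle0; rewrite prod_even_opp // big_seq; apply: prodr_ge0 => r rs.
by rewrite oppr_ge0 Fle0.
Qed.

Lemma prod_even_lt0 s (F : K -> K) :
  ~~ odd (size s) -> {in s, forall r, F r < 0} -> 0 < \prod_(r <- s) F r.
Proof.
move=> es Flt0; rewrite prod_even_opp // big_seq; apply: prodr_gt0 => r rs.
by rewrite oppr_gt0 Flt0.
Qed.

(** At a double root the sign of the second derivative is that of the cofactor, which is how a
    condition on P'' rules out a bad double root. *)
Lemma deriv_double_root z P :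
  (('X - z%:P) ^+ 2 * P)^`().[z] = 0 /\
  (('X - z%:P) ^+ 2 * P)^`()^`().[z] = 2 * P.[z].
Proof.
have D : (('X - z%:P) ^+ 2 * P)^`() = ('X - z%:P) * (2 *: P + ('X - z%:P) * P^`()).
  by rewrite expr2 !derivM derivXsubC scaler_nat; ring.
split; first by rewrite D hornerM hornerXsubC subrr mul0r.
by rewrite D derivM derivXsubC !hornerE; ring.
Qed.

Lemma sorted_catP s1 s2 l r : sorted <=%R (s1 ++ [:: l, r & s2]) ->
  [/\ {in s1, forall x, x <= l}, l <= r & {in s2, forall x, r <= x}].
Proof.
rewrite sorted_pairwise; last exact: le_trans.
rewrite pairwise_cat => /and3P[/allrelP s1s _ /= /and3P[/andP[lr _] /allP rs2 _]].
by split=> // x xs; apply: s1s => //; rewrite !inE eqxx.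
Qed.

Lemma root_poly_pair s1 s2 l r :
  root_poly (s1 ++ [:: l, r & s2]) =
  ('X - l%:P) * ('X - r%:P) * (root_poly s1 * root_poly s2).
Proof. by rewrite /root_poly big_cat !big_cons /=; ring. Qed.

(** If [l = r], this is a double root of P, and P'' there is twice the product of the other factors.
    Those from [s1] are nonnegative; those from [s2] are nonpositive and even in number. Hence P' =
    0 and P'' >= 0, against the hypothesis. *)
Lemma sorted_pair_lt s1 s2 l r (s := s1 ++ [:: l, r & s2]) :
  sorted <=%R s -> ~~ odd (size s2) ->
  {in s, forall z, (root_poly s)^`().[z] != 0 \/ (root_poly s)^`()^`().[z] < 0} ->
  l < r.
Proof.
move=> /sorted_catP[s1l lr rs2] e2 ds; rewrite lt_neqAle lr andbT.
apply/eqP => elr; have /ds : l \in s by rewrite mem_cat !inE eqxx orbT.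
rewrite /s root_poly_pair -elr -expr2.
have [-> ->] := deriv_double_root l (root_poly s1 * root_poly s2).
case=> [/eqP//|]; apply/negP; rewrite -leNgt hornerM !horner_root_poly.
rewrite mulr_ge0 // mulr_ge0 //; last first.
  by apply: prod_even_le0 => // x /rs2; rewrite elr subr_le0.
by rewrite big_seq; apply: prodr_ge0 => x /s1l; rewrite subr_ge0.
Qed.

Lemma root_poly_lt0 s1 s2 l r x (s := s1 ++ [:: l, r & s2]) :
  sorted <=%R s -> ~~ odd (size s2) -> l < x < r -> (root_poly s).[x] < 0.
Proof.
move=> /sorted_catP[s1l lr rs2] e2 /andP[lx xr].
rewrite /s root_poly_pair !hornerM !hornerXsubC !horner_root_poly.
rewrite pmulr_llt0; first by rewrite pmulr_rlt0 ?subr_gt0 // subr_lt0.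
apply: mulr_gt0.
  by rewrite big_seq; apply: prodr_gt0 => y /s1l /le_lt_trans/(_ lx); rewrite subr_gt0.
by apply: prod_even_lt0 => // y /rs2 /(lt_le_trans xr); rewrite subr_lt0.
Qed.

Lemma poly_ivtoo P a b : a < b -> P.[a] < 0 -> 0 < P.[b] ->
  exists2 c, a < c < b & root P c.
Proof.
move=> ab Pa Pb; have [|c /andP[ac cb] Pc] := @poly_ivt _ P a b (ltW ab).
  by rewrite !ltW.
exists c => //; rewrite !lt_neqAle ac cb !andbT.
apply/andP; split; first by apply: contraTneq Pc => <-; rewrite /root lt_eqF.
by apply: contraTneq Pc => ->; rewrite /root gt_eqF.
Qed.

Lemma poly_ivtoo_dec P a b : a < b -> 0 < P.[a] -> P.[b] < 0 ->
  exists2 c, a < c < b & root P c.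
Proof.
move=> ab Pa Pb; have := @poly_ivtoo (- P) a b ab; rewrite !hornerN oppr_lt0 oppr_gt0.
by case=> // c acb; rewrite rootN; exists c.
Qed.

(** Induction on [s2], two roots at a time, with [s1] collecting the roots already passed. R is -1
    at the roots of P and, for large [a], positive at the midpoint of each pair, so it changes sign
    twice in between. The bound [lb] keeps the new roots strictly increasing, hence distinct. *)
Lemma perturbed_roots_between P M s1 s2 lb (s := s1 ++ s2) :
    P = root_poly s -> sorted <=%R s -> ~~ odd (size s2) ->
    {in s, forall z, z <= M} ->
    {in s, forall z, P^`().[z] != 0 \/ P^`()^`().[z] < 0} ->
    {in s2, forall z, lb <= z} ->
  exists A, forall a, A <= a -> exists ws,
    [/\ size ws = size s2, path <%R lb ws, all (fun w => w < M) ws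
      & all (root (('X - a%:P) * P - 1)) ws].
Proof.
rewrite {}/s => defP; have [n] := ubnP (size s2).
elim: n => // n IHn in s1 s2 lb defP *.
case: s2 => [|l [|r s2]] //= in defP * => [*|].
  by exists 0 => a _; exists [::].
rewrite ltnS => lt_s2 ss; rewrite negbK => e2 sM ds lbs.
have lbl : lb <= l by apply: lbs; rewrite inE eqxx.
have rM : r <= M by apply: sM; rewrite mem_cat !inE eqxx !orbT.
have Pl : P.[l] = 0.
  by rewrite defP root_poly_pair !hornerM !hornerXsubC subrr !mul0r.
have Pr : P.[r] = 0.
  by rewrite defP root_poly_pair !hornerM !hornerXsubC subrr mulr0 !mul0r.
have lr : l < r by apply: (sorted_pair_lt ss e2); rewrite -defP.
pose m := (l + r) / 2.
have lm : l < m by rewrite /m; lra.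
have mr : m < r by rewrite /m; lra.
have Pm : P.[m] < 0 by rewrite defP; apply: (root_poly_lt0 ss e2); rewrite lm mr.
have [|||||||A IHA] := IHn (rcons (rcons s1 l) r) s2 r; rewrite ?cat_rcons //.
- exact: ltnW.
- by move=> z zs; have [_ _] := sorted_catP ss; apply.
(* R vanishes at [m] exactly when [a] is [m - P.[m]^-1]; the extra 1 makes R positive there. *)
exists (Num.max A (m - P.[m]^-1 + 1)) => a; rewrite ge_max => /andP[/IHA[ws [sz pw wM wR]] am].
pose R := ('X - a%:P) * P - 1; rewrite -/R in wR *.
have RE x : R.[x] = (x - a) * P.[x] - 1.
  by rewrite /R !hornerE.
have Rl : R.[l] < 0 by rewrite RE Pl; lra.
have Rr : R.[r] < 0 by rewrite RE Pr; lra.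
have Rm : 0 < R.[m].
  have -> : R.[m] = - ((a - (m - P.[m]^-1)) * P.[m]).
    by rewrite RE -(mulVf (negbT (lt_eqF Pm))); ring.
  by rewrite oppr_gt0 pmulr_rlt0 //; lra.
have [u /andP[lu um] Ru] := poly_ivtoo lm Rl Rm.
have [v /andP[mv vr] Rv] := poly_ivtoo_dec mr Rm Rr.
exists [:: u, v & ws]; split=> /=.
- by rewrite sz.
- rewrite (le_lt_trans lbl lu) (lt_trans um mv) /=.
  by case: ws pw {sz wM wR} => //= w ws /andP[rw ->]; rewrite (lt_trans vr rw).
- by rewrite wM !andbT (lt_le_trans (lt_trans um mr) rM) ?(lt_le_trans vr rM).
- by rewrite Ru Rv.
Qed.

(** The roots found between those of P are distinct and one fewer than the degree of R, so they
    leave a monic linear cofactor, whose root is [y]. *)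
Lemma perturbed_root_poly s M (P := root_poly s) :
    ~~ odd (size s) -> {in s, forall z, - M <= z <= M} ->
    {in s, forall z, P^`().[z] != 0 \/ P^`()^`().[z] < 0} ->
  exists A, forall a, A <= a -> exists y ws,
    [/\ size ws = size s, all (fun w => - M < w < M) ws, a < y
      & ('X - a%:P) * P - 1 = root_poly (y :: ws)].
Proof.
move=> es sM ds; pose s' := sort <=%R s.
have ps : perm_eq s' s by rewrite perm_sort.
have ms : s' =i s by exact: perm_mem.
have Ps' : P = root_poly s' by rewrite /P /root_poly (perm_big _ ps).
have [|||||A HA] := @perturbed_roots_between P M [::] s' (- M) Ps'.
- exact: sort_sorted le_total s.
- by rewrite size_sort.
- by move=> z; rewrite ms => /sM/andP[].
- by move=> z; rewrite ms => /ds.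
- by move=> z; rewrite ms => /sM/andP[].
exists (Num.max A M) => a; rewrite ge_max => /andP[/HA[ws [szw pw wM wR]] Ma].
rewrite size_sort in szw; set R := ('X - a%:P) * P - 1 in wR *.
have sP : size P = (size s).+1 by rewrite /P size_prod_XsubC.
have mXP : ('X - a%:P) * P \is monic by rewrite rpredM ?monicXsubC ?root_poly_monic.
have sXP : size (('X - a%:P) * P) = (size s).+2.
  by rewrite size_monicM ?monicXsubC ?monic_neq0 ?root_poly_monic // size_XsubC sP.
have sR : size R = (size s).+2.
  by rewrite /R size_polyDl ?sXP // size_polyN size_poly1.
have mR : R \is monic.
  by rewrite monicE /R lead_coefDl ?sXP ?size_polyN ?size_poly1 // (monicP mXP).
have uw : uniq ws by have := sorted_uniq lt_trans ltxx (path_sorted pw).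
have [Q defR] : exists Q, R = Q * root_poly ws.
  have [|Q ->] := uniq_roots_prod_XsubC wR; first by rewrite uniq_rootsE.
  by exists Q.
have mQ : Q \is monic by rewrite -(monicMr _ (root_poly_monic ws)) -defR.
have sQ : size Q = 2%N.
  have := sR; rewrite defR size_Mmonic ?monic_neq0 ?root_poly_monic //.
  by rewrite size_prod_XsubC szw addnS -[_.+2]add2n => /addIn.
have [y defQ] : exists y, Q = 'X - y%:P.
  exists (- Q`_0); rewrite polyCN opprK; apply/polyP => i.
  rewrite coefD coefX coefC; case: i => [|[|i]] /=; first by rewrite add0r.
    by move: (mQ); rewrite monicE /lead_coef sQ => /eqP ->; rewrite addr0.
  by rewrite nth_default ?sQ // addr0.
exists y, ws; split=> //; last by rewrite defR defQ /root_poly big_cons.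
  apply/allP => w ww; rewrite (allP wM _ ww) andbT.
  by have /allP-> := order_path_min lt_trans pw.
(* If [y <= a], every factor of R(a) would be nonnegative, because [a >= M] lies above all of
   [ws]. *)
have : R.[a] = -1 by rewrite /R !hornerE; ring.
rewrite defR defQ hornerM hornerXsubC horner_root_poly => Ra.
rewrite ltNge -subr_ge0; apply/negP => ya.
have : 0 <= (a - y) * \prod_(r <- ws) (a - r).
  rewrite mulr_ge0 // big_seq; apply: prodr_ge0 => w /(allP wM) wltM.
  by rewrite subr_ge0 (le_trans (ltW wltM)).
by rewrite Ra ler0N1.
Qed.
End RealRoots.
(** * Salem numbers from trace polynomials *)

Notation pZtoC := (map_poly (intr : int -> algC)).

Section Joukowski.
Variable A : comNzRingType.
Implicit Types (p : {poly A}) (s : seq A).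

(* [joukowski d p] is [X^d p(X + 1/X)], a polynomial when [deg p <= d]. *)
Definition joukowski d p : {poly A} :=
  \sum_(i < d.+1) p`_i *: ('X^(d - i) * ('X^2 + 1) ^+ i).

(** This is x (x + 1/x - c) = x^2 - c x + 1. The size bound makes the coefficient of index [d.+1]
    vanish. *)
Lemma joukowski_XsubC_mul d p c : (size p <= d.+1)%N ->
  joukowski d.+1 (('X - c%:P) * p) = ('X^2 - c *: 'X + 1) * joukowski d p.
Proof.
move=> sp; rewrite /joukowski mulrBl addrAC; set Y := 'X^2 + 1.
under eq_bigr do rewrite coefB coefXM coefCM scalerBl.
rewrite sumrB big_ord_recl /= scale0r add0r [X in _ - X]big_ord_recr /=.
rewrite [p`_d.+1]nth_default //.
rewrite mulr0 scale0r addr0 mulrBl; congr (_ - _).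
  rewrite mulr_sumr; apply: eq_bigr => i _; rewrite /bump /= subSS exprS.
  by rewrite -!scalerAr mulrCA.
rewrite mulr_sumr; apply: eq_bigr => i _ /=; rewrite subSn -1?ltnS // exprS.
by rewrite -!mul_polyC polyCM; ring.
Qed.

Lemma joukowski_prod_XsubC s :
  joukowski (size s) (\prod_(r <- s) ('X - r%:P)) =
  \prod_(r <- s) ('X^2 - r *: 'X + 1).
Proof.
elim: s => [|r s IHs]; last first.
  by rewrite !big_cons /= joukowski_XsubC_mul ?IHs // size_prod_XsubC.
by rewrite !big_nil /joukowski big_ord1 coef1 scale1r !expr0 mulr1.
Qed.

End Joukowski.

Lemma map_joukowski (A B : comNzRingType) (f : {rmorphism A -> B}) d p :
  map_poly f (joukowski d p) = joukowski d (map_poly f p).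
Proof.
rewrite /joukowski rmorph_sum; apply: eq_bigr => i _ /=.
by rewrite map_polyZ /= rmorphM !rmorphXn rmorphD /= rmorphXn rmorph1 /= map_polyX coef_map.
Qed.

(** * The map x -> x + 1/x: real values and the unit circle *)

Section JoukowskiMap.
Variable C : numClosedFieldType.

Lemma exists_joukowski (y : C) : exists2 x, x != 0 & x + x^-1 = y.
Proof.
pose x := (y + sqrtC (y ^+ 2 - 4)) / 2.
have xE : x ^+ 2 + 1 = y * x.
  have := sqrtCK (y ^+ 2 - 4); rewrite /x; set d := sqrtC _ => dE.
  have -> : ((y + d) / 2) ^+ 2 + 1 = (y ^+ 2 + 2 * (y * d) + d ^+ 2 + 4) / 4 by field.
  by rewrite dE; field.
have x0 : x != 0.
  by apply/eqP => xe; move: xE; rewrite xe expr0n mulr0 add0r => /eqP; rewrite oner_eq0.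
by exists x => //; apply: (mulIf x0); rewrite mulrDl mulVf // -xE.
Qed.

Lemma norm1_joukowski (x : C) : `|x| = 1 ->
  x + x^-1 \is Num.real /\ `|x + x^-1| <= 2.
Proof.
move=> x1; have x0 : x != 0 by rewrite -normr_eq0 x1 oner_eq0.
have xV : x^-1 = x^* by rewrite invC_norm x1 expr1n invr1 mul1r.
split; last by apply: le_trans (ler_normD _ _) _; rewrite normfV x1 invr1 lexx.
by rewrite xV; apply/CrealP; rewrite rmorphD /= conjCK addrC.
Qed.

(** The conjugate of x + 1/x minus x + 1/x itself factors as (conj x - x) (1 - 1/|x|^2). *)
Lemma real_joukowski_dichotomy (x : C) : x != 0 -> x + x^-1 \is Num.real ->
  x \is Num.real \/ `|x| = 1.
Proof.
move=> x0 /CrealP; rewrite rmorphD /= fmorphV => xx.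
have xc0 : x^* != 0 by rewrite conjC_eq0.
have /eqP : (x^* - x) * (1 - (x * x^*)^-1) = 0.
  have -> : (x^* - x) * (1 - (x * x^*)^-1) = (x^* + x^*^-1) - (x + x^-1) by field; rewrite x0.
  by rewrite xx subrr.
rewrite mulf_eq0 !subr_eq0 => /orP[/eqP xr|/eqP x1]; first by left; apply/CrealP.
right; apply/eqP; rewrite -(@eqrXn2 _ 2%N) ?normr_ge0 ?ler01 // expr1n normCK.
by rewrite -[_ * _]invrK -x1 invr1.
Qed.

Lemma real_joukowski_lt0 (x : C) : x < 0 -> x + x^-1 < 0.
Proof. by move=> x0; rewrite -oppr_gt0 opprD addr_gt0 ?oppr_gt0 ?invr_lt0. Qed.

Lemma real_joukowski_ge2 (x : C) : x != 0 -> x \is Num.real -> 2 <= `|x + x^-1|.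
Proof.
move=> x0 xr; have nx : 0 < `|x| by rewrite normr_gt0.
have -> : `|x + x^-1| = `|x| + `|x|^-1.
  have [x_gt0|x_lt0|/eqP] := real_ltgtP (rpred0 _) xr; last by rewrite eq_sym (negPf x0).
    by rewrite !gtr0_norm ?addr_gt0 ?invr_gt0.
  by rewrite (ltr0_norm x_lt0) ltr0_norm ?real_joukowski_lt0 // invrN -opprD.
rewrite -subr_ge0.
have -> : `|x| + `|x|^-1 - 2 = (`|x| - 1) ^+ 2 / `|x| by field; rewrite gt_eqF.
by rewrite divr_ge0 ?normr_ge0 // real_exprn_even_ge0 // rpredB ?normr_real ?rpred1.
Qed.

Lemma joukowski_lt2_norm1 (x : C) : x != 0 ->
  x + x^-1 \is Num.real -> `|x + x^-1| < 2 -> `|x| = 1.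
Proof.
move=> x0 xr x2; case: (real_joukowski_dichotomy x0 xr) => // /(real_joukowski_ge2 x0).
by rewrite real_leNgt ?x2.
Qed.

Lemma joukowski_gt2 (y : C) : y \is Num.real -> 2 < y ->
  exists2 x, 1 < x & x + x^-1 = y.
Proof.
move=> yr y2; have [x x0 xy] := exists_joukowski y.
have y0 : 0 < y by rewrite (lt_trans _ y2).
have xr : x \is Num.real.
  have [] // := real_joukowski_dichotomy x0; first by rewrite xy.
  move=> /norm1_joukowski[_]; rewrite xy gtr0_norm // => /(lt_le_trans y2).
  by rewrite ltxx.
have x_gt0 : 0 < x.
  have [//|x_lt0|/eqP] := real_ltgtP (rpred0 _) xr; last by rewrite eq_sym (negPf x0).
  have : x + x^-1 < 0 by exact: real_joukowski_lt0.
  by rewrite xy => /(lt_trans y0); rewrite ltxx.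
have [x1|x1|x1] := real_ltgtP (rpred1 _) xr; first by exists x.
  by exists x^-1; rewrite ?invf_gt1 // invrK addrC.
by move: y2; rewrite -xy -x1 invr1 ltxx.
Qed.

End JoukowskiMap.

(** * Integer factors and norms *)

Lemma root_small_minCpoly x (q : {poly int}) : root (pZtoC q) x ->
  (size q < size (minCpoly x))%N -> q = 0.
Proof.
have [p [-> pm] pP] := minCpolyP x; rewrite size_map_poly.
have -> : pZtoC q = map_poly ratr (map_poly (intr : int -> rat) q).
  by rewrite -map_poly_comp; apply: eq_map_poly => z /=; rewrite ratr_int.
have sq : size (map_poly (intr : int -> rat) q) = size q.
  by rewrite size_map_inj_poly //; exact: intr_inj.
rewrite pP -sq => /dvdp_leq pq spq; apply/eqP; rewrite -size_poly_eq0 -sq size_poly_eq0.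
by apply: contraLR spq; rewrite -leqNgt.
Qed.

(** Since [x] is an algebraic integer, its minimal polynomial is integral; being monic, it divides
    [S] with remainder over the integers. The remainder vanishes at [x] and its degree is too small
    for it to be nonzero. *)
Lemma minCpoly_factor_int x (S : {poly int}) : S \is monic -> root (pZtoC S) x ->
  exists h m : {poly int},
    [/\ h \is monic, m \is monic, S = h * m & pZtoC m = minCpoly x].
Proof.
move=> mS rSx; have pC_inj : injective (intr : int -> algC) by exact: intr_inj.
have xA : x \in Aint.
  apply: root_monic_Aint rSx (monic_map _ mS) _.
  by apply/polyOverP => i; rewrite coef_map intr_int.
have /floorpP[m mE] := xA.
have mm : m \is monic.
  have := minCpoly_monic x; rewrite mE !monicE lead_coef_map_inj // -[1]/(1%:~R).
  by rewrite eqr_int.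
have eS := Pdiv.RingMonic.rdivp_eq mm S.
set r := Pdiv.Ring.rmodp S m in eS; set h := Pdiv.Ring.rdivp S m in eS.
have r0 : r = 0.
  apply: (@root_small_minCpoly x).
    move: rSx; rewrite eS rmorphD rmorphM /= -mE /root hornerD hornerM.
    by rewrite (eqP (root_minCpoly x)) mulr0 add0r.
  by rewrite mE size_map_inj_poly // Pdiv.Ring.ltn_rmodpN0 ?monic_neq0.
rewrite r0 addr0 in eS; exists h, m; split=> //.
by rewrite -(monicMr _ mm) -eS.
Qed.

(** Modulo X^2 - a X + 1 the polynomial [p] reduces to c + d X, and the product of its values at the
    two roots x and 1/x is c^2 + c d a + d^2. *)
Lemma int_quadratic_norm (p : {poly int}) (a : int) : exists N : int,
  forall x : algC, x != 0 -> x + x^-1 = a%:~R ->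
    (pZtoC p).[x] * (pZtoC p).[x^-1] = N%:~R.
Proof.
have [c [d pE]] : exists c d : int, forall x : algC, x != 0 -> x + x^-1 = a%:~R ->
    (pZtoC p).[x] = c%:~R + d%:~R * x.
  elim/poly_ind: p => [|p e [c [d pE]]].
    by exists 0, 0 => x _ _; rewrite rmorph0 horner0 mul0r addr0.
  (* Obtained from (c + d x) x + e by x^2 = a x - 1. *)
  exists (e - d), (c + d * a) => x x0 xa.
  rewrite rmorphD rmorphM /= map_polyX map_polyC /= !hornerE pE //.
  by rewrite !(intrD, intrM, intrN) -xa; field.
exists (c ^+ 2 + c * d * a + d ^+ 2) => x x0 xa.
rewrite !pE ?invr_neq0 // ?invrK 1?addrC //.
by rewrite !(intrD, intrM, rmorphXn) /= -xa; field.
Qed.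

Lemma joukowski_factorE (C : numClosedFieldType) (x w : C) : x != 0 ->
  x ^+ 2 - w * x + 1 = x * (x + x^-1 - w).
Proof. by move=> x0; field. Qed.

(** * A criterion for Salem numbers *)

Section SalemCriterion.
Variables (R : {poly int}) (a : nat) (y : algC) (ws : seq algC).
Hypothesis defR : pZtoC R = \prod_(w <- y :: ws) ('X - w%:P).
Hypothesis yR : y \is Num.real.
Hypothesis y2 : 2 < y.
Hypothesis wsR : {in ws, forall w, w \is Num.real /\ `|w| < 2}.
Hypothesis a3 : (3 <= a)%N.
Hypothesis Ra : R.[a%:Z] = -1.
Hypothesis ws0 : ws != [::].

(** The candidate minimal polynomial of alpha, of twice the degree of [R]. *)
Let S := joukowski (size ws).+1 R.

Let SE : pZtoC S = \prod_(w <- y :: ws) ('X^2 - w *: 'X + 1).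
Proof. by rewrite /S map_joukowski defR -joukowski_prod_XsubC. Qed.

Let hornerS x : x != 0 ->
  (pZtoC S).[x] = x ^+ (size ws).+1 * (pZtoC R).[x + x^-1].
Proof.
move=> x0; rewrite SE defR !horner_prod.
have -> : x ^+ (size ws).+1 = \prod_(w <- y :: ws) x.
  by rewrite big_const_seq count_predT iter_mulr_1.
rewrite -big_split /=; apply: eq_bigr => w _.
by rewrite !hornerE joukowski_factorE.
Qed.

Let rootS x : x != 0 -> root (pZtoC S) x = (x + x^-1 \in y :: ws).
Proof.
move=> x0; rewrite /root hornerS // mulf_eq0 expf_eq0 (negPf x0) andbF /=.
by rewrite -[_ == 0]/(root _ _) defR root_prod_XsubC.
Qed.

Let S0 : (pZtoC S).[0] = 1.
Proof.
rewrite SE horner_prod big1 // => w _.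
by rewrite !hornerE expr0n /= ?mulr0 ?subr0 ?add0r.
Qed.

Let factor_monic (w : algC) (q := 'X^2 - w *: 'X + 1 : {poly algC}) :
  q \is monic /\ size q = 3%N.
Proof.
have -> : q = 'X^2 + (1 - w *: 'X) by rewrite /q; ring.
have s2 : (size (1 - w *: 'X)%R < size ('X^2 : {poly algC})%R)%N.
  rewrite size_polyXn ltnS (leq_trans (size_polyD _ _)) // geq_max size_poly1 /=.
  by rewrite size_polyN (leq_trans (size_scale_leq _ _)) // size_polyX.
by rewrite monicE lead_coefDl // lead_coefXn size_polyDl // size_polyXn.
Qed.

Let prod_monic s : \prod_(w <- s) ('X^2 - w *: 'X + 1 : {poly algC}) \is monic /\
  size (\prod_(w <- s) ('X^2 - w *: 'X + 1 : {poly algC})) = (2 * size s).+1.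
Proof.
elim: s => [|w s [ms ss]]; first by rewrite big_nil monic1 size_poly1.
have [mw sw] := factor_monic w.
rewrite big_cons rpredM // size_monicM ?monic_neq0 // sw ss; split=> //=.
by rewrite mulnS.
Qed.

Let SCmonic : pZtoC S \is monic.
Proof. by rewrite SE; case: (prod_monic (y :: ws)). Qed.

Let size_SC : size (pZtoC S) = (2 * (size ws).+1).+1.
Proof. by rewrite SE; case: (prod_monic (y :: ws)). Qed.

Let Smonic : S \is monic.
Proof.
have pC_inj : injective (intr : int -> algC) by exact: intr_inj.
by have := SCmonic; rewrite !monicE lead_coef_map_inj // -[1]/(1%:~R) eqr_int.
Qed.

(** With [S = h * m] and [m] minimal for alpha, the aim is [h = 1]: the roots of [h] are first shown
    to lie on the unit circle, then the norm of [h] at x + 1/x = a excludes any root. *)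
Lemma salem_of_trace_poly : exists al : algC,
  [/\ salem al, alg_degree al = (2 * (size ws).+1)%N, 1 < al & al + al^-1 = y].
Proof.
have [al al1 aly] := joukowski_gt2 yR y2.
have al0 : al != 0 by rewrite gt_eqF // (lt_trans _ al1).
exists al.
have alR : al \is Num.real by rewrite ger0_real // (le_trans _ (ltW al1)).
have Sal : root (pZtoC S) al by rewrite rootS // aly mem_head.
have [h [m [mh mm Shm mE]]] := minCpoly_factor_int Smonic Sal.
have SC : pZtoC S = pZtoC h * pZtoC m by rewrite Shm rmorphM.
have rS x : root (pZtoC S) x ->
    x != 0 /\ ([\/ x = al, x = al^-1 | `|x| = 1]).
  move=> rx; have x0 : x != 0.
    by apply: contraTneq rx => ->; rewrite /root S0 oner_eq0.
  split=> //; move: rx; rewrite rootS // inE => /orP[/eqP xy|/wsR[wR w2]].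
    have /eqP : (x - al) * (1 - al^-1 * x^-1) = 0.
      have -> : (x - al) * (1 - al^-1 * x^-1) = (x + x^-1) - (al + al^-1).
        by field; rewrite al0.
      by rewrite xy aly subrr.
    rewrite mulf_eq0 !subr_eq0 => /orP[/eqP->|/eqP e1]; first by constructor 1.
    by constructor 2; apply: (mulIf (invr_neq0 x0)); rewrite mulfV.
  by constructor 3; apply: joukowski_lt2_norm1.
have yws : y \notin ws.
  apply/negP => /wsR[_]; rewrite gtr0_norm ?(lt_trans _ y2) // => /(lt_trans y2).
  by rewrite ltxx.
(* alpha and 1/alpha are simple roots of S. *)
have simple x : x != 0 -> x + x^-1 = y -> root (pZtoC m) x -> ~~ root (pZtoC h) x.
  move=> x0 xy rm; apply/negP => rh.
  have [h' hE] := factor_theorem _ _ rh; have [m' m'E] := factor_theorem _ _ rm.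
  pose T : {poly algC} := \prod_(w <- ws) ('X^2 - w *: 'X + 1).
  have QE : 'X^2 - y *: 'X + 1 = ('X - x^-1%:P) * ('X - x%:P).
    rewrite -xy -mul_polyC polyCD.
    have -> : 1 = x^-1%:P * x%:P :> {poly algC} by rewrite -polyCM mulVf.
    by ring.
  (* A common root [x] would be double in [S]. After cancelling one factor, evaluation at [x] gives
     either x = 1/x, so that |x| = 1 and y <= 2, or y in [ws]. *)
  have eT : h' * m' * ('X - x%:P) = ('X - x^-1%:P) * T.
    apply: (mulIf (negbT (polyXsubC_eq0 x))).
    rewrite [RHS]mulrAC -QE.
    by have := SE; rewrite big_cons => <-; rewrite SC hE m'E; ring.
  have := congr1 (fun p => p.[x]) eT; rewrite /= !hornerM !hornerXsubC subrr mulr0.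
  move/esym/eqP; rewrite mulf_eq0 subr_eq0 => /orP[/eqP xx|].
    have x1 : `|x| = 1.
      apply/eqP; rewrite -(@eqrXn2 _ 2%N) ?normr_ge0 ?ler01 // expr1n expr2 {2}xx.
      by rewrite -normrM mulfV ?normr1.
    have [_] := norm1_joukowski x1; rewrite xy gtr0_norm ?(lt_trans _ y2) //.
    by move/(lt_le_trans y2); rewrite ltxx.
  rewrite /T horner_prod prodf_seq_eq0 => /hasP[w ww].
  rewrite !hornerE joukowski_factorE // xy mulf_eq0 (negPf x0) /= subr_eq0 => /eqP yw.
  by rewrite yw ww in yws.
have rm_al : root (pZtoC m) al by rewrite mE root_minCpoly.
have mdvd x : root (pZtoC m) x -> root (pZtoC S) x by rewrite SC rootM orbC => ->.
have hdvd x : root (pZtoC h) x -> root (pZtoC S) x by rewrite SC rootM => ->.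
have hmC : pZtoC h \is monic by exact: monic_map.
have mmC : pZtoC m \is monic by exact: monic_map.
have [rh hE] := closed_field_poly_normal (pZtoC h).
have [rm m_E] := closed_field_poly_normal (pZtoC m).
rewrite (monicP hmC) scale1r in hE; rewrite (monicP mmC) scale1r in m_E.
have rhP x : (x \in rh) = root (pZtoC h) x by rewrite hE root_prod_XsubC.
have rmP x : (x \in rm) = root (pZtoC m) x by rewrite m_E root_prod_XsubC.
have h0m0 : h.[0] * m.[0] = 1.
  have := S0; rewrite SC -(rmorph0 (intr : int -> algC)) hornerM !horner_map /=.
  by rewrite -intrM -[1]/(1%:~R) => /intr_inj.
have m0 : `|(pZtoC m).[0]| = 1.
  rewrite -(rmorph0 (intr : int -> algC)) horner_map /= -intr_norm.
  have /eqP : (`|h.[0]| * `|m.[0]| = 1)%N by rewrite -abszM h0m0.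
  by rewrite muln_eq1 => /andP[_ /eqP]; rewrite -abszE => ->.
(* Otherwise 1/alpha is not a root of [m], so all roots of [m] have modulus at least 1, and alpha
   has more; this contradicts |m(0)| = 1. *)
have halV : ~~ root (pZtoC h) al^-1.
  apply/negP => rhV.
  have mge1 w : w \in rm -> 1 <= `|w|.
    rewrite rmP => rw; have [_ [->|wV|->//]] := rS _ (mdvd _ rw).
      by rewrite gtr0_norm ?(lt_trans ltr01) // ltW.
    by have := simple _ (invr_neq0 al0); rewrite invrK addrC aly rhV -wV rw => /(_ erefl isT).
  have := m0; rewrite m_E horner_prod (perm_big _ (perm_to_rem (_ : al \in rm))) ?rmP //.
  rewrite big_cons normrM hornerXsubC sub0r normrN (gtr0_norm (lt_trans ltr01 al1)).
  move=> e1; have : al * 1 <= 1.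
    rewrite -{2}e1 ler_pM2l ?(lt_trans ltr01) // normr_prod.
    rewrite big_seq; elim/big_rec: _ => // w p /mem_rem/mge1 w1 p1.
    by rewrite hornerXsubC sub0r normrN mulr_ege1.
  by rewrite mulr1 => /(lt_le_trans al1); rewrite ltxx.
have rh1 w : w \in rh -> `|w| = 1.
  rewrite rhP => rw; have [_ [wE|wE|//]] := rS _ (hdvd _ rw).
    by have := simple al al0 aly rm_al; rewrite -wE rw.
  by rewrite wE (negPf halV) in rw.
have h1 : h = 1.
  have [x x0 xa] := exists_joukowski (a%:R : algC).
  have [Nh NhE] := int_quadratic_norm h a%:Z.
  have [Nm NmE] := int_quadratic_norm m a%:Z.
  have xaZ : x + x^-1 = (a%:Z)%:~R by rewrite xa.
  have Sx z : z != 0 -> z + z^-1 = (a%:Z)%:~R -> (pZtoC S).[z] = - z ^+ (size ws).+1.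
    by move=> z0 za; rewrite hornerS // za horner_map Ra mulrN1.
  (* The powers of x and 1/x cancel in S(x) S(1/x), and the two signs coming from R(a) = -1 do
     too. *)
  have NN : Nh * Nm = 1.
    apply: (@intr_inj algC); rewrite intrM -(NhE x) // -(NmE x) // mulrACA.
    rewrite -!hornerM -!SC !Sx ?invr_neq0 // ?invrK 1?addrC // mulrNN -exprMn mulfV //.
    by rewrite expr1n.
  have Nh1 : `|(Nh%:~R : algC)| = 1.
    have /eqP : (`|Nh| * `|Nm| = 1)%N by rewrite -abszM NN.
    by rewrite -intr_norm muln_eq1 => /andP[/eqP]; rewrite -abszE => ->.
  have NhP : `|(Nh%:~R : algC)| = \prod_(w <- rh) `|a%:R - (w + w^-1)|.
    rewrite -(NhE x) // hE !horner_prod -big_split normr_prod big_seq [RHS]big_seq.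
    apply: eq_bigr => w /rh1 w1 /=; rewrite !hornerXsubC.
    have w0 : w != 0 by rewrite -normr_eq0 w1 oner_eq0.
    have -> : (x - w) * (x^-1 - w) = - w * (x + x^-1 - (w + w^-1)).
      by field; rewrite w0 x0.
    by rewrite normrM normrN w1 mul1r xa.
  case: rh {rhP} hE rh1 NhP => [|w rh] hE rh1 NhP.
    apply: (map_inj_poly (f := intr : int -> algC)); rewrite ?rmorph1 //; first exact: intr_inj.
    by rewrite hE big_nil.

  (* Here [3 <= a] matters: |z + 1/z| is strictly below 2, since z + 1/z lies in [ws] and cannot be
     [y]. *)
  have aw z : z \in w :: rh -> 1 < `|a%:R - (z + z^-1)|.
    move=> zrh; have z1 := rh1 _ zrh; have [zR z2] := norm1_joukowski z1.
    have rz : root (pZtoC S) z by apply: hdvd; rewrite hE root_prod_XsubC.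
    have [z0 _] := rS _ rz; rewrite rootS // inE in rz.
    have z_lt2 : `|z + z^-1| < 2.
      case/orP: rz => [/eqP zy|/wsR[_ //]].
      by move: z2; rewrite zy gtr0_norm ?(lt_trans _ y2) // => /(lt_le_trans y2); rewrite ltxx.
    apply: lt_le_trans (lerB_dist _ _); rewrite normr_nat ltrBrDr.
    by apply: lt_le_trans (_ : 1 + 2 <= _); rewrite ?ltrD2l // -(natrD _ 1 2) ler_nat.
  have : 1 < `|(Nh%:~R : algC)|.
    rewrite NhP big_cons big_seq; have := aw _ (mem_head w rh).
    elim/big_rec: _ => [|z p zrh IHp w1]; first by rewrite mulr1.
    by rewrite mulrCA mulr_egt1 // ?IHp // aw // inE zrh orbT.
  by rewrite Nh1 ltxx.
have minE : minCpoly al = pZtoC S by rewrite -mE Shm h1 mul1r.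
have conjP z : conjugate al z = root (pZtoC S) z by rewrite /conjugate minE.
split=> //; last by rewrite /alg_degree minE size_SC.
split=> //.
- rewrite unfold_in minE; by apply/polyOverP => i; rewrite coef_map intr_int.
- move=> z; rewrite conjP => /rS[_ [->|->|->]] //; first by rewrite eqxx.
  by move=> _; rewrite normfV invf_le1 ?normr_gt0 // gtr0_norm ?ltW // (lt_trans ltr01).
(* Any member of [ws] yields a conjugate on the unit circle. *)
case: ws ws0 wsR rootS => // w ws' _ wR rS'.
have [z z0 zw] := exists_joukowski w.
have [wr w2] := wR _ (mem_head w ws').
exists z; first by rewrite conjP rS' // zw !inE eqxx orbT.
by apply: joukowski_lt2_norm1; rewrite ?zw.
Qed.

End SalemCriterion.
(** * Chebyshev polynomials in x + 1/x *)

Section Lucas.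
Variable A : comNzRingType.
Implicit Types (n : nat) (p q : {poly A}).

Fixpoint lucas (p q : {poly A}) n : {poly A} :=
  if n is n'.+1 then
    if n' is n''.+1 then 'X * lucas p q n' - lucas p q n'' else q
  else p.

Lemma lucasSS p q n : lucas p q n.+2 = 'X * lucas p q n.+1 - lucas p q n.
Proof. by []. Qed.

(** Rescaled Chebyshev polynomials: at x + 1/x, [chebV n] is x^n + x^-n and [chebU n] is (x^n -
    x^-n)/(x - 1/x). As (x - 1/x)^2 = (x + 1/x)^2 - 4, [chebE n] is (x - 1/x)(x^n - x^-n), so E is
    [chebE (2 * k)]. *)
Definition chebV := lucas 2 'X.
Definition chebU := lucas 0 1.
Definition chebE n := ('X^2 - 4) * chebU n.

Lemma lucas_ind2 (P : nat -> Prop) :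
  P 0%N -> P 1%N -> (forall n, P n -> P n.+1 -> P n.+2) -> forall n, P n.
Proof.
move=> P0 P1 PS n; suff [] : P n /\ P n.+1 by [].
by elim: n => // n [Pn PSn]; split=> //; apply: PS.
Qed.

Lemma lucas_monic p q : q \is monic -> (size p <= size q)%N -> 
  forall n, lucas p q n.+1 \is monic /\ size (lucas p q n.+1) = (size q + n)%N.
Proof.
move=> mq sp; suff H n : [/\ lucas p q n.+1 \is monic,
    size (lucas p q n.+1) = (size q + n)%N & (size (lucas p q n) <= size q + n)%N].
  by move=> n; case: (H n).
elim: n => [|n [mn sn sn']]; first by rewrite addn0.
have sX : size ('X * lucas p q n.+1) = (size q + n.+1)%N.
  by rewrite mulrC size_mulX ?monic_neq0 // sn addnS.
have ltn : (size (- lucas p q n)%R < size ('X * lucas p q n.+1)%R)%N.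
  by rewrite size_polyN sX addnS ltnS.
rewrite lucasSS; split; last by rewrite sn leq_add2l.
  by rewrite monicE lead_coefDl // lead_coef_Mmonic // lead_coefX.
by rewrite size_polyDl.
Qed.

Lemma chebV_SS n : chebV n.+2 = 'X * chebV n.+1 - chebV n.
Proof. by []. Qed.

Lemma chebU_SS n : chebU n.+2 = 'X * chebU n.+1 - chebU n.
Proof. by []. Qed.

Lemma chebV_E n : chebV n = 2 * chebU n.+1 - 'X * chebU n.
Proof.
elim/lucas_ind2: n => [||n IH0 IH1]; first by rewrite /chebV /chebU /=; ring.
  by rewrite /chebV /chebU /=; ring.
by rewrite chebV_SS IH0 IH1 !chebU_SS; ring.
Qed.

(** This is what x d/dx makes of (x - 1/x) U(x + 1/x) = x^n - x^-n, after which the recurrence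
    proves it over any ring. *)
Lemma deriv_chebU n :
  ('X^2 - 4) * (chebU n)^`() = chebV n *+ n - 'X * chebU n.
Proof.
elim/lucas_ind2: n => [||n IH0 IH1].
- by rewrite /chebU /= linear0; ring.
- by rewrite /chebU /chebV /= -polyC1 derivC; ring.
rewrite chebU_SS derivB derivM derivX mulrBr mulrDr [_ * ('X * _)]mulrCA IH0 IH1.
rewrite chebV_SS !chebV_E !chebU_SS; ring.
Qed.

Lemma chebV_S n : chebV n.+1 = 'X * chebU n.+1 - 2 * chebU n.
Proof. by rewrite chebV_E chebU_SS; ring. Qed.

Lemma deriv_chebV n : (chebV n)^`() = chebU n *+ n.
Proof.
elim/lucas_ind2: n => [||n IH0 IH1].
- by rewrite /chebV /= -polyC_natr derivC.
- by rewrite /chebV /= derivX.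
rewrite chebV_SS derivB derivM derivX IH0 IH1 chebV_S.
by rewrite chebU_SS; ring.
Qed.

Lemma deriv_chebE n : (chebE n)^`() = chebV n *+ n + 'X * chebU n.
Proof.
rewrite /chebE derivM deriv_chebU derivB derivXn -polyC_natr derivC /=.
by rewrite expr1; ring.
Qed.

Lemma chebV_monic n : (0 < n)%N -> chebV n \is monic /\ size (chebV n) = n.+1.
Proof.
case: n => // n _.
rewrite /chebV; have [||m s] := @lucas_monic 2 'X _ _ n; rewrite ?monicX //.
  by rewrite size_polyX -polyC_natr (leq_trans (size_polyC_leq1 _)).
by rewrite m s size_polyX.
Qed.

Lemma chebE_monic n : (0 < n)%N -> chebE n \is monic /\ size (chebE n) = n.+2.
Proof.
case: n => // n _.
have [||m s] := @lucas_monic 0 1 _ _ n; rewrite ?monic1 ?size_poly0 //.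
have -> : chebE n.+1 = ('X^2 - (4%:R)%:P) * lucas 0 1 n.+1 by rewrite polyC_natr.
rewrite rpredM ?monicXnsubC // size_monicM ?monicXnsubC ?monic_neq0 //.
by rewrite size_XnsubC // s size_poly1.
Qed.

End Lucas.

Lemma map_lucas (A B : comNzRingType) (f : {rmorphism A -> B}) p q n :
  map_poly f (lucas p q n) = lucas (map_poly f p) (map_poly f q) n.
Proof.
elim/lucas_ind2: n => // n IH0 IH1.
by rewrite !lucasSS rmorphB rmorphM /= map_polyX IH0 IH1.
Qed.

Lemma map_chebV (A B : comNzRingType) (f : {rmorphism A -> B}) n :
  map_poly f (chebV A n) = chebV B n.
Proof. by rewrite /chebV map_lucas map_polyX rmorph_nat. Qed.

Lemma map_chebE (A B : comNzRingType) (f : {rmorphism A -> B}) n :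
  map_poly f (chebE A n) = chebE B n.
Proof.
by rewrite /chebE /chebU rmorphM rmorphB /= map_polyXn rmorph_nat map_lucas rmorph0 rmorph1.
Qed.

(** * Values at x + 1/x and simplicity of roots *)

Section TracePoly.
Variable C : numClosedFieldType.
Implicit Types (f g : {poly C}) (x y : C).

Lemma chebV_joukowski n x : x != 0 -> (chebV C n).[x + x^-1] = x ^+ n + x ^- n.
Proof.
move=> x0; elim/lucas_ind2: n => [||n IH0 IH1].
- by rewrite -[chebV C 0]/2 -polyC_natr hornerC invr1.
- by rewrite -[chebV C 1]/'X hornerX expr1.
rewrite chebV_SS hornerD hornerN hornerM hornerX IH0 IH1 !exprS.
by field; rewrite x0 expf_neq0.
Qed.

Lemma chebU_joukowski n x : x != 0 ->
  (x - x^-1) * (chebU C n).[x + x^-1] = x ^+ n - x ^- n.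
Proof.
move=> x0; elim/lucas_ind2: n => [||n IH0 IH1].
- by rewrite /chebU /= horner0 expr0 invr1 subrr mulr0.
- by rewrite /chebU /= -polyC1 hornerC mulr1 expr1.
rewrite chebU_SS hornerD hornerN hornerM hornerX mulrBr mulrCA IH0 IH1 !exprS.
by field; rewrite x0 expf_neq0.
Qed.

Lemma chebE_joukowski n x : x != 0 ->
  (chebE C n).[x + x^-1] = (x - x^-1) * (x ^+ n - x ^- n).
Proof.
move=> x0; rewrite -chebU_joukowski // /chebE hornerM hornerD hornerN hornerXn.
by rewrite -polyC_natr hornerC; field.
Qed.

Lemma addrV_eq0 x : x != 0 -> (x + x^-1 == 0) = (x ^+ 2 == -1).
Proof.
by move=> x0; rewrite -(mulIr_eq0 _ (mulIf x0)) mulrDl mulVf // -expr2 addr_eq0.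
Qed.

Lemma subrV_eq0 x : x != 0 -> (x - x^-1 == 0) = (x ^+ 2 == 1).
Proof.
by move=> x0; rewrite -(mulIr_eq0 _ (mulIf x0)) mulrBl mulVf // -expr2 subr_eq0.
Qed.

Lemma root_chebV n x : x != 0 -> root (chebV C n) (x + x^-1) = (x ^+ (2 * n) == -1).
Proof.
by move=> x0; rewrite /root chebV_joukowski // addrV_eq0 ?expf_neq0 // -exprM mulnC.
Qed.

Lemma root_chebE n x : x != 0 ->
  root (chebE C n) (x + x^-1) = (x ^+ 2 == 1) || (x ^+ (2 * n) == 1).
Proof.
move=> x0; rewrite /root chebE_joukowski // mulf_eq0 !subrV_eq0 ?expf_neq0 //.
by rewrite -exprM mulnC.
Qed.

(** Every number is some x + 1/x, so this says that all roots of [f] are simple, real and in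
    [-2, 2]. Keeping x in view reduces coprimality to orders of roots of unity. *)
Definition simple_trace_poly f := forall x, x != 0 -> root f (x + x^-1) ->
  `|x| = 1 /\ f^`().[x + x^-1] != 0.

Lemma simple_trace_polyM f g : simple_trace_poly f -> simple_trace_poly g ->
  (forall x, x != 0 -> root f (x + x^-1) -> ~~ root g (x + x^-1)) ->
  simple_trace_poly (f * g).
Proof.
move=> sf sg dfg x x0; rewrite rootM derivM hornerD !hornerM.
case/orP=> rx; have rx0 := eqP rx; rewrite rx0 ?(mulr0, mul0r, add0r, addr0) mulf_eq0.
  have [-> /negPf->] := sf _ x0 rx; split=> //=; exact: dfg.
have [-> /negPf->] := sg _ x0 rx; split=> //; rewrite orbF.
by apply/negP => /(dfg _ x0); rewrite rx.
Qed.

Lemma expr_norm1 n x : (0 < n)%N -> `|x ^+ n| = 1 -> `|x| = 1.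
Proof.
by move=> n0; rewrite normrX => /eqP; rewrite pexpr_eq1 // => /eqP.
Qed.

Lemma chebE_simple n : (0 < n)%N -> simple_trace_poly (chebE C n).
Proof.
move=> n0 x x0; rewrite root_chebE // orb_idl => [/eqP xn|/eqP x2]; last first.
  by rewrite exprM x2 expr1n.
split; first by apply: (@expr_norm1 (2 * n)); rewrite ?muln_gt0 // xn normr1.
have xnV : x ^- n = x ^+ n.
  apply: (mulfI (expf_neq0 n x0)).
  by rewrite mulfV ?expf_neq0 // -expr2 -exprM mulnC xn.
set y := x + x^-1; have Vy : (chebV C n).[y] = 2 * x ^+ n.
  by rewrite chebV_joukowski // xnV; ring.
have V0 : (chebV C n).[y] != 0 by rewrite Vy mulf_neq0 ?expf_neq0 // pnatr_eq0.
rewrite deriv_chebE hornerD hornerMn hornerM hornerX.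
(* Away from x = 1/x, U vanishes and E' = n V. At x = 1/x, y^2 = 4 and [deriv_chebU] gives y U = n
   V, so E' = 2 n V. *)
have [x1|x1] := eqVneq (x - x^-1) 0; last first.
  have -> : (chebU C n).[y] = 0.
    by apply: (mulfI x1); rewrite mulr0 chebU_joukowski // xnV subrr.
  by rewrite mulr0 addr0 mulrn_eq0 negb_or -lt0n n0.
have := congr1 (fun p => p.[y]) (deriv_chebU C n).
rewrite /= hornerM !hornerD !hornerN hornerXn !hornerMn hornerM hornerX.
rewrite -polyC1 hornerC.
have -> : y ^+ 2 - 4 = (x - x^-1) ^+ 2 by rewrite /y; field.
rewrite x1 expr0n mul0r => /esym/eqP; rewrite subr_eq0 => /eqP <-.
by rewrite -mulr2n !mulrn_eq0 negb_or /= negb_or -lt0n n0.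
Qed.

Lemma chebV_simple n : (0 < n)%N -> simple_trace_poly (chebV C n).
Proof.
move=> n0 x x0; rewrite root_chebV // => /eqP xn.
split; first by apply: (@expr_norm1 (2 * n)); rewrite ?muln_gt0 // xn normrN normr1.
rewrite deriv_chebV hornerMn mulrn_eq0 negb_or -lt0n n0 /=.
have /eqP := chebU_joukowski n x0; apply: contraTneq => ->.
rewrite mulr0 eq_sym subrV_eq0 ?expf_neq0 // -exprM mulnC xn.
by rewrite eqNr oner_eq0.
Qed.
End TracePoly.

(** * From a trace polynomial G to a family of Salem numbers *)

Lemma real_seq_algR (rs : seq algC) : {in rs, forall r, r \is Num.real} ->
  exists s : seq algR, map algRval s = rs.
Proof.
elim: rs => [|r rs IHrs] rR; first by exists [::].
have [s <-] := IHrs (fun x xrs => rR x (mem_behead (s := r :: rs) xrs)).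
by exists (in_algR (rR r (mem_head r rs)) :: s).
Qed.

Lemma map_root_poly_algR (s : seq algR) :
  map_poly algRval (root_poly s) = \prod_(r <- map algRval s) ('X - r%:P).
Proof.
rewrite /root_poly rmorph_prod big_map; apply: eq_bigr => r _.
by rewrite rmorphB /= map_polyX map_polyC.
Qed.

(** The perturbation is applied over [algR] to P = (Y - z) G, whose degree is [size G]. The last
    equation exhibits the inverse of G(y), which is what makes alpha^n - 1 a unit. *)
Lemma salem_family (G : {poly int}) (z : int) :
    G \is monic -> ~~ odd (size G) -> simple_trace_poly (pZtoC G) -> `|z| <= 2 ->
    (root G z -> G^`().[z] < 0) ->
  exists A : nat, forall a, (A <= a)%N -> exists al : algC,
    let y := al + al^-1 in
    [/\ salem al, alg_degree al = (2 * (size G).+1)%N,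
        y \in Aint, a%:R < y & (y - a%:R) * ((y - z%:~R) * (pZtoC G).[y]) = 1].
Proof.
move=> mG eG sG z2 dG.
have [rs GE] := closed_field_poly_normal (pZtoC G).
have mGC : pZtoC G \is monic by exact: monic_map.
rewrite (monicP mGC) scale1r in GE.
have rsP r : (r \in rs) = root (pZtoC G) r by rewrite GE root_prod_XsubC.
have rs_real r : r \in rs -> r \is Num.real /\ `|r| <= 2.
  rewrite rsP; have [x x0 <-] := exists_joukowski r.
  by move=> /(sG _ x0)[x1 _]; exact: norm1_joukowski.
pose zC : algC := z%:~R.
have zs_real r : r \in zC :: rs -> r \is Num.real /\ `|r| <= 2.
  rewrite inE => /orP[/eqP->|/rs_real//]; split; first exact: realz.
  by rewrite /zC -intr_norm -[2]/(2%:~R) ler_int.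
have [s sE] := real_seq_algR (fun r rin => proj1 (zs_real r rin)).
have szG : size G = (size rs).+1.
  have pC_inj : injective (intr : int -> algC) by exact: intr_inj.
  by rewrite -(size_map_inj_poly pC_inj) // GE size_prod_XsubC.
have szs : size s = size G by rewrite -(size_map algRval) sE szG.
pose P := ('X - z%:P) * G.
have PE : map_poly algRval (root_poly s) = pZtoC P.
  rewrite map_root_poly_algR sE big_cons -GE /P rmorphM rmorphB /= map_polyX.
  by rewrite map_polyC.
have vhorner (p : {poly algR}) (r : algR) : algRval p.[r] = (map_poly algRval p).[algRval r].
  by rewrite horner_map.
have PdE : (pZtoC P)^`() = pZtoC G + ('X - zC%:P) * (pZtoC G)^`().
  by rewrite /P rmorphM rmorphB /= map_polyX map_polyC derivM derivXsubC mul1r.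
have Pd1 r : (pZtoC P)^`().[r] = (pZtoC G).[r] + (r - zC) * (pZtoC G)^`().[r].
  by rewrite PdE hornerD hornerM hornerXsubC.
have Pd2 : (pZtoC P)^`()^`().[zC] = 2 * (pZtoC G)^`().[zC].
  rewrite PdE derivD derivM derivXsubC mul1r !hornerD hornerM hornerXsubC subrr.
  by rewrite mul0r addr0 mulr2n mulrDl !mul1r.
have sP r : r \in s -> algRval r \in zC :: rs by rewrite -sE; exact: map_f.
have GzE : (pZtoC G).[zC] = (G.[z])%:~R by rewrite horner_map.
have G'zE : (pZtoC G)^`().[zC] = (G^`().[z])%:~R by rewrite deriv_map horner_map.
have [|||A HA] := @perturbed_root_poly algR s 2.
- by rewrite szs.
- by move=> r /sP /zs_real[rR]; rewrite real_ler_norml.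
- move=> r /sP rin.
  have d1 : algRval (root_poly s)^`().[r] = (pZtoC P)^`().[algRval r].
    by rewrite vhorner -PE deriv_map.
  have d2 : algRval (root_poly s)^`()^`().[r] = (pZtoC P)^`()^`().[algRval r].
    by rewrite vhorner -PE !deriv_map.
  (* At a root r other than z, P' = (r - z) G'(r) is nonzero by simplicity. At z, P' = G(z), and if
     this vanishes then P'' = 2 G'(z) < 0. *)
  have [rz|rz] := eqVneq (algRval r) zC; last first.
    left; apply/eqP => /(congr1 algRval); rewrite d1 Pd1 => /eqP; apply/negP.
    move: rin; rewrite inE (negPf rz) /= rsP => rGr; rewrite (eqP rGr) add0r.
    rewrite mulf_neq0 ?subr_eq0 //.
    have [x x0 xr] := exists_joukowski (algRval r); rewrite -xr in rGr *.
    by have [] := sG _ x0 rGr.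
  have [/eqP Gz|Gz] := boolP (root G z).
    right; change (algRval (root_poly s)^`()^`().[r] < 0); rewrite d2 rz Pd2 G'zE.
    rewrite pmulr_rlt0 ?ltr0n // -[0]/(0%:~R) ltr_int.
    by apply: dG; apply/eqP.
  left; apply/eqP => /(congr1 algRval); rewrite d1 rz Pd1 subrr mul0r addr0 GzE rmorph0.
  by move/eqP; rewrite intr_eq0; apply/negP.
pose B := Num.bound `|algRval A|; exists (maxn B 3) => a; rewrite geq_max => /andP[Ba a3].
have [|y [ws [szw wsM ay RE]]] := HA a%:R.
  change (algRval A <= algRval a%:R); rewrite rmorph_nat.
  have := archi_boundP (normr_ge0 (algRval A)); rewrite -/B => AB.
  have := real_ler_norm (valP A). move=> /le_trans; apply.
  by rewrite (le_trans (ltW AB)) // ler_nat.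
pose R := ('X - (a%:Z)%:P) * P - 1.
have RC1 : pZtoC R = ('X - a%:R%:P) * pZtoC P - 1.
  by rewrite /R rmorphB rmorphM rmorphB /= rmorph1 map_polyX map_polyC.
have RCE : pZtoC R = \prod_(w <- algRval y :: map algRval ws) ('X - w%:P).
  rewrite -[_ :: _]/(map algRval (y :: ws)) -map_root_poly_algR -RE.
  have -> : map_poly algRval (('X - a%:R%:P) * root_poly s - 1) =
      ('X - (algRval a%:R)%:P) * pZtoC P - 1.
    by rewrite rmorphB rmorphM rmorphB /= rmorph1 map_polyX map_polyC PE.
  by rewrite rmorph_nat RC1.
have a_lt_y : a%:R < algRval y.
  by move: ay; rewrite -[a%:R < y]/(algRval a%:R < algRval y) rmorph_nat.
have [||||||al [sal dal al1 aly]] := @salem_of_trace_poly R a (algRval y) (map algRval ws) RCE.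
- exact: valP.
- by apply: lt_trans a_lt_y; rewrite ltr_nat.
- move=> _ /mapP[w ww ->]; split; first exact: valP.
  have /andP[w1 w2] := allP wsM _ ww.
  by rewrite real_ltr_norml ?(valP w) //; apply/andP; split.
- by [].
- by rewrite /R hornerD hornerN hornerC hornerM hornerXsubC subrr mul0r add0r.
- by rewrite -size_eq0 size_map szw szs szG.
exists al; rewrite /= aly; split=> //.
- by rewrite dal size_map szw szs.
- apply: (@root_monic_Aint (pZtoC R)).
  + by rewrite RCE root_prod_XsubC mem_head.
  + by rewrite RCE monic_prod_XsubC.
  + by apply/polyOverP => i; rewrite coef_map intr_int.
have : root (pZtoC R) (algRval y) by rewrite RCE root_prod_XsubC mem_head.
rewrite RC1 /P rmorphM rmorphB /= map_polyX map_polyC /root.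
by rewrite hornerD hornerN hornerC !hornerM !hornerXsubC subr_eq0 => /eqP.
Qed.

Local Open Scope classical_set_scope.
(** * The cofactor and the theorem *)

Lemma horner_lucasSS (p q : {poly int}) (z : int) n :
  (lucas p q n.+2).[z] = z * (lucas p q n.+1).[z] - (lucas p q n).[z].
Proof. by rewrite lucasSS hornerD hornerN hornerM hornerX. Qed.

Lemma chebV_at0 j : (chebV int (2 * j)).[0] = 2 * (-1) ^+ j.
Proof.
elim: j => [|j IHj]; first by rewrite -[chebV _ _]/(2%:R) -polyC_natr hornerC.
by rewrite mulnS /chebV horner_lucasSS mul0r add0r IHj exprS; ring.
Qed.

(** -1 is w + 1/w for a primitive cube root of unity w, so the values have period 3. *)
Lemma cheb_atN1 q :
  [/\ (chebU int (3 * q)).[-1] = 0, (chebU int (3 * q).+1).[-1] = 1,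
      (chebV int (3 * q)).[-1] = 2 & (chebV int (3 * q).+1).[-1] = -1].
Proof.
elim: q => [|q [U0 U1 V0 V1]].
  rewrite -[chebU _ _]/0 -[chebU _ _]/1 -[chebV _ _]/(2%:R) -[chebV _ _]/'X.
  by rewrite horner0 hornerX -polyC1 -polyC_natr !hornerC.
have US (n : nat) : (chebU int n.+2).[-1] = - 1 * (chebU int n.+1).[-1] - (chebU int n).[-1].
  exact: horner_lucasSS.
have VS (n : nat) : (chebV int n.+2).[-1] = - 1 * (chebV int n.+1).[-1] - (chebV int n).[-1].
  exact: horner_lucasSS.
by rewrite mulnS !add3n !US !VS U0 U1 V0 V1.
Qed.

Lemma chebV_atN1 n : ~~ (3 %| n)%N -> (chebV int n).[-1] = -1.
Proof.
rewrite {2}(divn_eq n 3) mulnC /dvdn; have := ltn_pmod n (isT : (0 < 3)%N).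
have [_ _ V0 V1] := cheb_atN1 (n %/ 3).
case: (n %% 3)%N => [|[|[|r]]] //= _ _; first by rewrite addn1.
by rewrite addn2 /chebV horner_lucasSS -/(chebV _ _) V1 V0.
Qed.

Lemma deriv_chebE_at0 k : odd k -> (chebE int (2 * k))^`().[0] < 0.
Proof.
move=> ok; rewrite deriv_chebE hornerD hornerMn hornerM hornerX mul0r addr0.
rewrite chebV_at0 -signr_odd ok expr1 mulrN1 pmulrn_llt0 //.
by rewrite muln_gt0 (odd_gt0 ok).
Qed.

(** Since Y^2 - 4 is -3 at -1, U vanishes there, which forces 3 to divide n; then E' = n V = 2 n. *)
Lemma deriv_chebE_atN1 n : (0 < n)%N ->
  root (chebE int n) (-1) -> 0 < (chebE int n)^`().[-1].
Proof.
move=> n0 rE; have U0 : (chebU int n).[-1] == 0.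
  move: rE; rewrite /root /chebE hornerM hornerD hornerN hornerXn -polyC_natr.
  by rewrite hornerC mulf_eq0.
rewrite deriv_chebE hornerD hornerMn hornerM hornerX (eqP U0) mulr0 addr0.
have [Uq Uq1 Vq _] := cheb_atN1 (n %/ 3).
have nE := divn_eq n 3; rewrite mulnC in nE; move: U0 (ltn_pmod n (isT : (0 < 3)%N)).
rewrite {1 3}nE; case: (n %% 3)%N => [|[|[|r]]] //.
- by rewrite addn0 Vq pmulrn_lgt0.
- by rewrite addn1 Uq1.
- by rewrite addn2 /chebU horner_lucasSS -/(chebU _ _) Uq1 Uq.
Qed.

(** A common root would give x^(4k) = 1 and x^(4a) = -1; the k-th power of the latter is -1 because
    k is odd. *)
Lemma chebE_chebV_coprime (C : numClosedFieldType) k a (x : C) : odd k -> x != 0 ->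
  root (chebE C (2 * k)) (x + x^-1) -> ~~ root (chebV C (2 * a)) (x + x^-1).
Proof.
move=> ok x0; rewrite root_chebE // root_chebV // => xE; apply/eqP => xa.
have x4k : x ^+ (4 * k) = 1.
  case/orP: xE => /eqP; last by rewrite mulnA.
  by rewrite -[4%N]/(2 * 2)%N -mulnA exprM => ->; rewrite expr1n.
have := congr1 (fun u => u ^+ k) xa; rewrite -exprM mulnA mulnAC exprM x4k expr1n.
by rewrite -signr_odd ok expr1 => /eqP; rewrite eq_sym eqNr oner_eq0.
Qed.

(** * The quadratic factor from the tenth roots of unity *)

Definition trace10 (A : comNzRingType) : {poly A} := 'X^2 - 'X - 1.

Lemma map_trace10 (A B : comNzRingType) (f : {rmorphism A -> B}) :
  map_poly f (trace10 A) = trace10 B.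
Proof. by rewrite /trace10 !rmorphB /= rmorphXn /= map_polyX rmorph1. Qed.

Lemma trace10_monic (A : comNzRingType) :
  trace10 A \is monic /\ size (trace10 A) = 3%N.
Proof.
have lt2 : (size (- 'X - 1 : {poly A})%R < size ('X^2 : {poly A})%R)%N.
  rewrite size_polyXn -opprD size_polyN ltnS (leq_trans (size_polyD _ _)) //.
  by rewrite size_polyX size_poly1.
rewrite /trace10 -addrA monicE lead_coefDl // lead_coefXn size_polyDl //.
by rewrite size_polyXn.
Qed.

Section Trace10.
Variable C : numClosedFieldType.
Implicit Type x : C.

Lemma horner_trace10 (A : comNzRingType) (y : A) : (trace10 A).[y] = y ^+ 2 - y - 1.
Proof. by rewrite /trace10 !hornerE. Qed.

(** X^2 (Y^2 - Y - 1) is the tenth cyclotomic polynomial, and X + 1 times it is X^5 + 1. *)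
Lemma root_trace10 x : x != 0 -> root (trace10 C) (x + x^-1) -> x ^+ 5 = -1.
Proof.
move=> x0; rewrite /root horner_trace10 => /eqP e0; apply/eqP; rewrite -subr_eq0.
have -> : x ^+ 5 - -1 = x ^+ 2 * (x + 1) * ((x + x^-1) ^+ 2 - (x + x^-1) - 1) by field.
by rewrite e0 mulr0.
Qed.

Lemma trace10_simple : simple_trace_poly (trace10 C).
Proof.
move=> x x0 rx; split.
  by apply: (@expr_norm1 _ 5) => //; rewrite root_trace10 // normrN normr1.
set y := x + x^-1 in rx *; apply: contraTneq rx.
rewrite /trace10 !derivB derivXn derivX -polyC1 derivC subr0 expr1.
rewrite hornerD hornerN hornerC hornerMn hornerX => dy.
rewrite /root -/(trace10 C) horner_trace10.
have -> : y ^+ 2 - y - 1 = ((y *+ 2 - 1) ^+ 2 - 5) / 4 by field.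
by rewrite dy expr0n /= sub0r mulf_neq0 ?invr_eq0 ?oppr_eq0 ?pnatr_eq0.
Qed.

Lemma chebE_trace10_coprime k x : odd k -> (k %% 5 != 0)%N -> x != 0 ->
  root (chebE C (2 * k)) (x + x^-1) -> ~~ root (trace10 C) (x + x^-1).
Proof.
move=> ok k5 x0; rewrite root_chebE // => xE; apply/negP => rx.
have x5 := root_trace10 x0 rx.
have x10 : x ^+ 10 = 1 by rewrite -[10%N]/(5 * 2)%N exprM x5 sqrrN expr1n.
have x4k : x ^+ (4 * k) = 1.
  case/orP: xE => /eqP; last by rewrite mulnA.
  by rewrite -[4%N]/(2 * 2)%N -mulnA exprM => ->; rewrite expr1n.
(* [m] is an inverse of [k] modulo 5. It gives x^4 = 1, and with x^5 = -1 this leaves only x = -1,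
   where the quadratic takes the value 5. *)
have [m m4] : exists m, (4 * k * m %% 10 = 4)%N.
  have : [|| k %% 5 == 1, k %% 5 == 2, k %% 5 == 3 | k %% 5 == 4]%N by lia.
  by case/or4P => /eqP kr; [exists 1%N|exists 3%N|exists 2%N|exists 4%N]; lia.
have x4 : x ^+ 4 = 1 by rewrite -m4 expr_mod // exprM x4k expr1n.
have xN : x = -1 by rewrite -x5 -[5%N]/4.+1 exprS x4 mulr1.
move: rx; rewrite xN /root horner_trace10 invrN invr1.
have -> : (-1 - 1) ^+ 2 - (-1 - 1) - 1 = 5%:R :> C by ring.
by rewrite pnatr_eq0.
Qed.

Lemma chebV_trace10_coprime a x : x != 0 ->
  root (trace10 C) (x + x^-1) -> ~~ root (chebV C (2 * a)) (x + x^-1).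
Proof.
move=> x0 /(root_trace10 x0) x5; rewrite root_chebV //; apply/eqP => xa.
have := congr1 (fun u => u ^+ 5) xa; rewrite -exprM.
have -> : (2 * (2 * a) * 5 = 5 * (2 * (2 * a)))%N by lia.
rewrite exprM x5 exprM sqrrN !expr1n -signr_odd expr1 => /eqP.
by rewrite eq_sym eqNr oner_eq0.
Qed.

End Trace10.

(* When s is even z = 0 works, since E'(0) < 0 for k odd.  When s is odd z = -1
   is used instead; the factor Y^2 - Y - 1, whose roots come from the primitive
   tenth roots of unity, is needed only to get F(-1) < 0 when 3 divides s, and
   it is prime to E because 5 does not divide k. *)
Lemma trace_cofactor k s : odd k -> (k %% 5 != 0)%N ->
  exists (F : {poly int}) (z : int),
    [/\ F \is monic, size F = (2 * s).+1, simple_trace_poly (pZtoC F),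
        forall x : algC, x != 0 -> root (chebE algC (2 * k)) (x + x^-1) ->
          ~~ root (pZtoC F) (x + x^-1)
      & `|z| <= 2 /\ F.[z] != 0 /\
        (root (chebE int (2 * k)) z -> (chebE int (2 * k))^`().[z] * F.[z] < 0)].
Proof.
move=> ok k5; have k0 := odd_gt0 ok.
have [os|es] := boolP (odd s); last first.
  case: s es => [_|s es].
    (* The case s = 0 is separate because [chebV 0] is the constant 2, which is not monic. *)
    exists 1, 0; split; rewrite ?monic1 ?size_poly1 //.
    - by move=> x _; rewrite rmorph1 (negPf (root1 _)).
    - by move=> x _ _; rewrite rmorph1 (negPf (root1 _)).
    by rewrite -polyC1 hornerC mulr1; split=> //; split=> // _; exact: deriv_chebE_at0.
  exists (chebV int (2 * s.+1)), 0; rewrite map_chebV.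
  have [|mV sV] := @chebV_monic int (2 * s.+1); first by [].
  split=> //; [exact: chebV_simple | by move=> x; exact: chebE_chebV_coprime |].
  rewrite chebV_at0 -signr_odd (negPf es) mulr1; split=> //; split=> // _.
  by rewrite pmulr_llt0 // deriv_chebE_at0.
have atN1 (F : {poly int}) : F.[-1] = -1 -> `|(-1 : int)| <= 2 /\ F.[-1] != 0 /\
    (root (chebE int (2 * k)) (-1) -> (chebE int (2 * k))^`().[-1] * F.[-1] < 0).
  move=> ->; split=> //; split=> // rE; rewrite mulrN1 oppr_lt0.
  by apply: deriv_chebE_atN1; rewrite // muln_gt0.
have [s3|s3] := boolP (3 %| s)%N; last first.
  have [|mV sV] := @chebV_monic int (2 * s); first by rewrite muln_gt0 (odd_gt0 os).
  exists (chebV int (2 * s)), (-1); rewrite map_chebV.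
  split=> //; [|by move=> x; exact: chebE_chebV_coprime|].
    by apply: chebV_simple; rewrite muln_gt0 (odd_gt0 os).
  by apply: atN1; apply: chebV_atN1; rewrite Euclid_dvdM.
have [r rE] : exists r, s = r.+3 by exists (s - 3)%N; lia.
have [|mV sV] := @chebV_monic int (2 * r.+2); first by [].
have [mq sq] := trace10_monic int.
(* For 3 dividing s, V of index 2s would be 2 at -1. Index 2(s - 1) gives -1 instead, and the
   quadratic, which is 1 at -1, restores the degree. *)
exists (trace10 int * chebV int (2 * r.+2)), (-1).
rewrite rmorphM /= map_chebV map_trace10; split.
- by rewrite rpredM.
- by rewrite size_monicM ?monic_neq0 // sq sV rE; lia.
- apply: simple_trace_polyM; first exact: trace10_simple.
    by apply: chebV_simple.
  by move=> x x0; exact: chebV_trace10_coprime.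
- move=> x x0 rx; rewrite rootM negb_or (chebE_trace10_coprime ok k5 x0 rx) /=.
  exact: (chebE_chebV_coprime _ ok x0 rx).
apply: atN1; rewrite hornerM horner_trace10 chebV_atN1; last first.
  by lia.
by rewrite expr2.
Qed.


Theorem theorem1p3 (n : nat) (hn8 : (n = 4 %[mod 8])%N)
    (hn5 : (n <> 0 %[mod 5])%N)
    (t : nat) (ht_odd : odd t) (ht : ((n + 6) %/ 2 <= t)%N) :
  infinite_set [set a : algC |
    [/\ salem a, alg_degree a = (2 * t)%N & alg_unit (a ^+ n - 1)]].
Proof.
have [k [s [nk tE ok k5]]] : exists k s : nat,
    [/\ n = (4 * k)%N, t = (2 * k + 3 + 2 * s)%N, odd k & (k %% 5 != 0)%N].
  exists (n %/ 4)%N, ((t - 2 * (n %/ 4) - 3) %/ 2)%N; split; lia.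
have k0 : (0 < 2 * k)%N by rewrite muln_gt0 (odd_gt0 ok).
have [F [z [mF sF simF cF [z2 [Fz dz]]]]] := @trace_cofactor k s ok k5.
have [mE sE] := chebE_monic int k0.
pose G := chebE int (2 * k) * F.
have sG : size G = (2 * k + 2 + 2 * s)%N by rewrite size_monicM ?monic_neq0 // sE sF; lia.
have tG : (2 * (size G).+1 = 2 * t)%N by rewrite sG; lia.
have [|||//||A HA] := @salem_family G z.
- by rewrite rpredM.
- by rewrite sG; lia.
- rewrite rmorphM /= map_chebE; apply: simple_trace_polyM => //.
  exact: chebE_simple.
- rewrite rootM [root F z](negPf Fz) orbF => rE; rewrite derivM hornerD.
  by rewrite hornerM [(_ * F^`()).[z]]hornerM (eqP rE) mul0r addr0; apply: dz.
rewrite nk; case/finite_seqP => l lE.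
(* Each alpha in [l] would satisfy alpha + 1/alpha < alpha + 1 < B, while the family provides one
   with alpha + 1/alpha > B. *)
pose B := Num.bound (\sum_(x <- l) (`|x| + 1)).
have [al [sal dal yA ay yE]] := HA (maxn A B) (leq_maxl _ _).
have [alR alA al1 _ _] := sal.
have al0 : al != 0 by rewrite gt_eqF // (lt_trans ltr01).
have alVA : al^-1 \in Aint.
  by rewrite -[al^-1](addKr al) rpredD // rpredN.
have pA (p : {poly int}) (x : algC) : x \in Aint -> (pZtoC p).[x] \in Aint.
  move=> xA; apply: rpred_horner => //; apply/polyOverP => i.
  by rewrite coef_map Aint_int.
set y := al + al^-1 in yA ay yE.
(* The inverse of alpha^(4k) - 1: multiplying by alpha^(-2k) (alpha - 1/alpha) gives E(y), and the
   remaining factors invert E(y). *)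
pose u := al^-1 ^+ (2 * k) * (al - al^-1) * ((y - (maxn A B)%:R) * ((y - z%:~R) * (pZtoC F).[y])).
have unit_eq : (al ^+ (4 * k) - 1) * u = 1.
  rewrite -[RHS]yE /u /G rmorphM hornerM /= map_chebE chebE_joukowski //.
  rewrite -[4%N]/(2 + 2)%N mulnDl exprD exprVn; have := expf_neq0 (2 * k) al0.
  move: (al ^+ (2 * k)) (pZtoC F).[y] (al - al^-1) => X f d X0.
  have XE : (X * X - 1) * X^-1 = X - X^-1 by rewrite mulrBl mulfK // mul1r.
  rewrite [LHS]mulrA [X in X * _]mulrA XE.
  move: (y - _) (y - _) (X - X^-1) => v w Z.
  by ring.
have al_set : al \in l.
  have : [set` l] al.
    rewrite -lE; split; [exact: sal | by rewrite dal |].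
    have e0 : al ^+ (4 * k) - 1 != 0.
      by apply/eqP => e; move: unit_eq; rewrite e mul0r => /eqP; rewrite eq_sym oner_eq0.
    split; [by rewrite rpredB ?rpredX ?rpred1 | exact: e0 |].
    have -> : (al ^+ (4 * k) - 1)^-1 = u.
      by apply: (mulfI e0); rewrite mulfV.
    by rewrite /u !(rpredM, rpredB, rpredX) ?pA ?Aint_int // Aint_Cnat.
  by [].
have : `|al| + 1 <= \sum_(x <- l) (`|x| + 1).
  rewrite (big_rem al) //= lerDl; apply: sumr_ge0 => x _.
  by rewrite addr_ge0 ?normr_ge0 ?ler01.
have S0 : 0 <= \sum_(x <- l) (`|x| + 1).
  by apply: sumr_ge0 => x _; rewrite addr_ge0 ?normr_ge0 ?ler01.
move=> /le_lt_trans/(_ (archi_boundP S0)); rewrite -/B gtr0_norm ?(lt_trans ltr01) // => al_lt.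
have : y < B%:R.
  apply: lt_trans al_lt; rewrite ltrD2l invf_lt1 //; exact: lt_trans al1.
apply/negP; rewrite -real_leNgt ?realn //; last first.
  by rewrite rpredD // rpredV.
by apply: le_trans (ltW ay); rewrite ler_nat leq_maxr.
Qed.
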